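(* Let $r$ be a prime number, let $E=\left\{\sum_{j=1}^\infty\eta_jr^{-2j} : \eta_j\in\{0,1,\ldots,r-1\}\right\}\subset\mathbb{R}\subset\mathbb{C}$ and let $E'=rE+i\subset\mathbb{C}$. Then the union of all line segments joining a point of $E$ to a point of $E'$, $$B=\{(1-h)z+hz' : z\in E,\ z'\in E',\ 0\le h\le 1\},$$ is a Besicovitch set in the following (wide) sense: $B$ has two-dimensional Lebesgue measure zero, and $B$ contains line segments in all directions belonging to some nonempty open set of directions.
   Context: The plane $\mathbb{R}^2$ is identified with $\mathbb{C}$, and $i$ is the imaginary unit. A Besicovitch set in the wide sense in $\mathbb{R}^n$ is a set of $n$-dimensional Lebesgue measure zero which contains (nondegenerate) line segments in all directions belonging to a nonempty open set of directions. *)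

(* Defs.v *)
From HB Require Import structures.
From mathcomp Require Import all_boot all_order all_algebra.
From mathcomp Require Import all_classical all_reals all_analysis.
From mathcomp Require Import complex.

Set Implicit Arguments.
Unset Strict Implicit.
Unset Printing Implicit Defensive.

Import Order.TTheory GRing.Theory Num.Theory.
Import numFieldNormedType.Exports.

Local Open Scope classical_set_scope.
Local Open Scope ring_scope.
Local Open Scope complex_scope.

(* The identification of C with R^2. The topology and the Lebesgue measure of
   the plane are those of the product R * R. *)
Definition plane_of (R : realType) (A : set R[i]) : set (R * R) :=
  [set p | A (p.1 +i* p.2)].

Definition unit_circle (R : realType) : set (R * R) :=
  [set u | u.1 ^+ 2 + u.2 ^+ 2 = 1].

(* Directions are unit vectors; a segment has both directions u and -u. The
   bound 0 < l makes the segment nondegenerate. *)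
Definition contains_segment (R : realType) (A : set (R * R)) (u : R * R) :=
  exists (p : R * R) (l : R), 0 < l /\
    forall t : R, 0 <= t <= l -> A (p.1 + t * u.1, p.2 + t * u.2).

(* Measure zero is negligibility, so that no Borel measurability of A is
   presupposed. A nonempty open set of directions is the trace on the unit
   circle of an open set U of the plane that meets the circle. *)
Definition besicovitch_wide (R : realType) (A : set (R * R)) : Prop :=
  (@lebesgue_measure R \x @lebesgue_measure R)%E.-negligible A /\
  exists U : set (R * R),
    [/\ open U, U `&` @unit_circle R !=set0 &
        forall u, (U `&` @unit_circle R) u -> contains_segment A u].

Definition digit_set (R : realType) (r : nat) : set R :=
  [set x | exists eta : nat -> 'I_r,
    (fun n : nat => \sum_(1 <= j < n.+1) (eta j)%:R * (r%:R : R) ^- (2 * j))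
      @ \oo --> x].

Definition setE (R : realType) (r : nat) : set R[i] :=
  [set x%:C | x in @digit_set R r].

Definition setE' (R : realType) (r : nat) : set R[i] :=
  [set r%:R * z + (0 +i* 1) | z in @setE R r].

Definition segment_union (R : realType) (C D : set R[i]) : set R[i] :=
  [set w | exists (z z' : R[i]) (h : R),
    [/\ C z, D z', 0 <= h <= 1 & w = (1 - h%:C) * z + h%:C * z']].

(* Main.v *)
Require Import Defs.
From mathcomp Require Import all_boot all_order all_algebra.
From mathcomp Require Import all_classical all_reals all_analysis.
From mathcomp Require Import measurable_realfun complex ring lra zify.

(** Put q = r^2. The slice of B at height h is a set of numbers
    (1 - h) x + h r x' with x, x' in E, so it is self-similar: its digits are the
    q numbers (1 - h) a + h r b, its ratio is 1/q, and it is covered, up to the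
    factor q^n, by intervals of length q attached to the q^n digit sums of
    length n.

    (i) If digit sums with different leading digits come arbitrarily close to
    each other, the slice K is null: if |K| > 0, the q pieces of measure |K|/q that
    make up K are essentially disjoint, but two of them contain small copies of K
    that almost coincide.

    (ii) At every length some two digit sums with different leading digits are at
    distance at most q. Otherwise the measure of the covering would be
    multiplied by exactly q from one length to the next, whereas grouping by
    the lowest digit shows that it grows by a strictly smaller factor.

    (iii) The difference of two digit sums is an affine function of h with a slope
    P that is large if the leading digits differ. By (ii) the zero of this
    function is within q/|P| of h, and within e/|P| of that zero the two sums are
    closer than e. Hence the set of h without e-close sums has no density point,
    and by the Lebesgue density theorem (i) applies to almost every h.

    Finally, r E - E is an interval because the numbers r x' + x with x, x' in E
    are all base-r expansions, and this interval gives the directions. *)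

Set Implicit Arguments.
Unset Strict Implicit.
Unset Printing Implicit Defensive.

Import Order.TTheory GRing.Theory Num.Theory.
Import numFieldNormedType.Exports.

Local Open Scope classical_set_scope.
Local Open Scope ring_scope.
Local Open Scope complex_scope.

(** * Finite Lebesgue measure on the line *)

Definition finmeas (R : realType) (A : set R) :=
  measurable A /\ (@lebesgue_measure R A < +oo)%E.

(** Real values open the estimates to linear arithmetic. Infinite measure is sent to 0, so [len] is
    meaningful under [finmeas] only. *)
Definition len (R : realType) (A : set R) : R := fine (@lebesgue_measure R A).

Lemma lenE (R : realType) (A : set R) : finmeas A ->
  lebesgue_measure A = (len A)%:E.
Proof. by move=> [mA fA]; rewrite fineK// ge0_fin_numE. Qed.

Lemma finmeas_sub (R : realType) (A B : set R) :
  finmeas B -> measurable A -> A `<=` B -> finmeas A.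
Proof.
move=> [mB fB] mA AB; split=> //; apply: le_lt_trans fB.
by apply: le_measure => //; rewrite inE.
Qed.

Lemma le_len (R : realType) (A B : set R) :
  finmeas B -> measurable A -> A `<=` B -> len A <= len B.
Proof.
move=> fB mA AB; have fA := finmeas_sub fB mA AB.
by rewrite -lee_fin -!lenE//; apply: le_measure; rewrite ?inE//; exact: fB.1.
Qed.

Lemma finmeasU (R : realType) (A B : set R) :
  finmeas A -> finmeas B -> finmeas (A `|` B).
Proof.
move=> [mA fA] [mB fB]; split; first exact: measurableU.
have h := @measureU2 _ _ _ (@lebesgue_measure R) _ _ mA mB.
by apply: le_lt_trans h _; exact: lte_add_pinfty.
Qed.

Lemma lenUI (R : realType) (A B : set R) : finmeas A -> finmeas B ->
  len (A `|` B) + len (A `&` B) = len A + len B.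
Proof.
move=> fA fB; have fI : finmeas (A `&` B).
  by apply: (finmeas_sub fA) => //; apply: measurableI; [exact: fA.1|exact: fB.1].
have := @measureUfinl _ _ _ (@lebesgue_measure R) A B fA.1 fB.1 fA.2.
rewrite /= !lenE//; last exact: finmeasU.
by move=> [->]; rewrite subrK.
Qed.

Lemma finmeas_itv (R : realType) (a b : R) : finmeas `[a, b].
Proof.
split; first exact: measurable_itv.
by rewrite /= lebesgue_measure_itv/=; case: ifP => _; rewrite -?EFinB ltry.
Qed.

Lemma len_itv (R : realType) (a b : R) : a <= b -> len `[a, b] = b - a.
Proof.
move=> ab; rewrite /len lebesgue_measure_itv/= lte_fin.
by case: ltgtP ab => // -> _; rewrite subrr.
Qed.

Section finite_union.
Context (R : realType) (I : finType) (A : I -> set R).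

Lemma fsum_lebesgueE : (forall i, finmeas (A i)) ->
  (\sum_(i \in [set: I]) lebesgue_measure (A i) = (\sum_i len (A i))%:E)%E.
Proof.
move=> fA; rewrite (fsbigE (index_enum I)) ?index_enum_uniq//=; last first.
  by move=> i _; rewrite mem_index_enum.
under eq_bigl do rewrite in_setT.
by under eq_bigr do rewrite lenE//; rewrite sumEFin.
Qed.

Lemma finmeas_bigcup : (forall i, finmeas (A i)) -> finmeas (\bigcup_i A i).
Proof.
move=> fA; have mA : measurable (\bigcup_i A i).
  by apply: fin_bigcup_measurable => // i _; exact: (fA i).1.
split=> //; have := @content_sub_fsum _ _ _ (@lebesgue_measure R) I setT _ A
  (@finite_finset _ _) (fun i _ => (fA i).1) mA (@subset_refl _ _).
move=> /le_lt_trans; apply.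
by rewrite /= fsum_lebesgueE// ltry.
Qed.

Lemma le_len_bigcup (B : set R) : (forall i, finmeas (A i)) -> measurable B ->
  B `<=` \bigcup_i A i -> len B <= \sum_i len (A i).
Proof.
move=> fA mB BA; have fB := finmeas_sub (finmeas_bigcup fA) mB BA.
have := @content_sub_fsum _ _ _ (@lebesgue_measure R) I setT B A
  (@finite_finset _ _) (fun i _ => (fA i).1) mB BA.
by rewrite /= fsum_lebesgueE// lenE// lee_fin.
Qed.

Lemma len_bigcup : (forall i, finmeas (A i)) -> trivIset setT A ->
  len (\bigcup_i A i) = \sum_i len (A i).
Proof.
move=> fA tA; apply/EFin_inj; rewrite -lenE//; last exact: finmeas_bigcup.
rewrite measure_fin_bigcup//=; last by move=> i _; exact: (fA i).1.
exact: fsum_lebesgueE.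
Qed.

End finite_union.

Section affine.
Context (R : realType) (a b : R).
Hypothesis a_gt0 : 0 < a.

Let f (x : R) : measurableTypeR R := a * x + b.

Let mf : measurable_fun setT f.
Proof. by apply: measurable_funD => //; exact: measurable_funM. Qed.

Lemma measurable_affine_preimage (A : set R) : measurable A ->
  measurable [set x | A (a * x + b)].
Proof. by move=> mA; rewrite -[X in measurable X]setTI; exact: mf. Qed.

(** Uniqueness of Lebesgue measure: the pushforward under [f], scaled by [a], agrees with it on
    half-open intervals. *)
Lemma lebesgue_affine_preimage (A : set R) : measurable A ->
  (lebesgue_measure A = a%:E * lebesgue_measure [set x | A (a * x + b)%R])%E.
Proof.
move=> mA.
have /(_ mf) := @lebesgue_measure_unique R (mscale (NngNum (ltW a_gt0))
  (pushforward (@lebesgue_measure R) f)) _ _ mA.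
apply=> _ [[c d]] _ <-.
apply: (@etrans _ _ (a%:E * lebesgue_measure (f @^-1` `]c, d]%classic))%E); last by [].
have E : f @^-1` `]c, d]%classic = `](c - b) / a, (d - b) / a]%classic.
  apply/seteqP; split=> x; rewrite /f /= !in_itv/= ltr_pdivrMr// ler_pdivlMr//;
  by rewrite ltrBlDr lerBrDr mulrC.
rewrite E !lebesgue_measure_itv/= !lte_fin ltr_pM2r ?invr_gt0// ltrD2r.
case: ifP => _; last by rewrite mule0.
by rewrite -!EFinB -EFinM; congr EFin; field; rewrite gt_eqF.
Qed.

Lemma finmeas_affine_preimage (A : set R) : finmeas A ->
  finmeas [set x | A (a * x + b)].
Proof.
move=> [mA]; have mA' := measurable_affine_preimage mA.
rewrite lebesgue_affine_preimage// => fA; split=> //.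
by move: fA; case: (lebesgue_measure _) => // [r _|]; rewrite ?ltry// gt0_muley// lte_fin.
Qed.

Lemma len_affine_preimage (A : set R) : finmeas A ->
  len A = a * len [set x | A (a * x + b)].
Proof.
move=> fA; apply: EFin_inj; rewrite -lenE// lebesgue_affine_preimage; last exact: fA.1.
by rewrite lenE//; exact: finmeas_affine_preimage.
Qed.

End affine.

(** * Digit sums with |I| digits in base |I| *)

Lemma finmeas_translate (R : realType) (s : R) (A : set R) : finmeas A ->
  finmeas [set x | A (x - s)].
Proof.
move=> fA; have := finmeas_affine_preimage (- s) ltr01 fA.
by congr finmeas; apply/seteqP; split=> x /=; rewrite mul1r.
Qed.

Lemma len_translate (R : realType) (s : R) (A : set R) : finmeas A ->
  len [set x | A (x - s)] = len A.
Proof.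
move=> fA; rewrite (len_affine_preimage (- s) ltr01 fA) mul1r; congr len.
by apply/seteqP; split=> x /=; rewrite mul1r.
Qed.

Lemma finmeas_dilate (R : realType) (k : R) (A : set R) : 0 < k -> finmeas A ->
  finmeas [set x | A (k^-1 * x)].
Proof.
move=> k0 fA; have k1 : 0 < k^-1 by rewrite invr_gt0.
have := finmeas_affine_preimage 0 k1 fA.
by congr finmeas; apply/seteqP; split=> x /=; rewrite addr0.
Qed.

Lemma len_dilate (R : realType) (k : R) (A : set R) : 0 < k -> finmeas A ->
  len [set x | A (k^-1 * x)] = k * len A.
Proof.
move=> k0 fA; have k1 : 0 < k^-1 by rewrite invr_gt0.
rewrite (len_affine_preimage 0 k1 fA) mulrA divff ?gt_eqF// mul1r; congr len.
by apply/seteqP; split=> x /=; rewrite addr0.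
Qed.

Lemma len0 (R : realType) : len (@set0 R) = 0.
Proof. by rewrite /len measure0. Qed.

Lemma lenD (R : realType) (A B : set R) : finmeas A -> finmeas B ->
  len (A `\` B) = len A - len (A `&` B).
Proof.
move=> fA fB.
have fD : finmeas (A `\` B).
  by apply: (finmeas_sub fA) => //; apply: measurableD; [exact: fA.1|exact: fB.1].
have fI : finmeas (A `&` B).
  by apply: (finmeas_sub fA) => //; apply: measurableI; [exact: fA.1|exact: fB.1].
have := lenUI fD fI.
have -> : (A `\` B) `|` (A `&` B) = A.
  by rewrite setDE -setIUr setUC setUv setIT.
have -> : (A `\` B) `&` (A `&` B) = set0.
  by apply/seteqP; split=> // x [[_ nB] [_ B']].
by rewrite len0 addr0 => ->; rewrite addrK.
Qed.

Section digit_sums.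
Context (R : realType) (I : finType) (dig : I -> R).

Local Notation q := (#|I|%:R : R).

(* The lowest digit comes first: [eta n] is the leading digit of
   [dsum n.+1 eta]. *)
Definition dsum (n : nat) (eta : nat -> I) : R :=
  \sum_(j < n) dig (eta j) * q ^+ j.

Lemma dsumS n eta : dsum n.+1 eta = dsum n eta + dig (eta n) * q ^+ n.
Proof. by rewrite /dsum big_ord_recr. Qed.

Lemma dsumSl n eta : dsum n.+1 eta = dig (eta 0%N) + q * dsum n (eta \o S).
Proof.
rewrite /dsum big_ord_recl expr0 mulr1; congr (_ + _).
by rewrite mulr_sumr; apply: eq_bigr => j _; rewrite exprS mulrCA.
Qed.

Lemma eq_dsum n eta zeta : (forall j, (j < n)%N -> eta j = zeta j) ->
  dsum n eta = dsum n zeta.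
Proof. by move=> e; apply: eq_bigr => j _; rewrite e. Qed.

Definition splice (m : nat) (eta zeta : nat -> I) (j : nat) : I :=
  if (j < m)%N then eta j else zeta (j - m)%N.

Lemma dsum_splice m n eta zeta :
  dsum (m + n) (splice m eta zeta) = dsum m eta + dsum n zeta * q ^+ m.
Proof.
rewrite /dsum big_split_ord/= /splice; congr (_ + _).
  by apply: eq_bigr => j _; rewrite ltn_ord.
rewrite mulr_suml; apply: eq_bigr => j _.
by rewrite ltnNge leq_addr/= addKn exprD mulrA mulrAC.
Qed.

Lemma dsum_rcons n eta i :
  dsum n.+1 (splice n eta (fun=> i)) = dsum n eta + dig i * q ^+ n.
Proof.
have := dsum_splice n 1 eta (fun=> i); rewrite addn1 => ->.
by congr (_ + _); rewrite /dsum big_ord1 expr0 mulr1.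
Qed.

(** The covering of the self-similar set at level [n], blown up by [q ^+ n]. The width [c] is a
    parameter because grouping by low digits changes it. *)
Definition thick (c : R) (n : nat) : set R :=
  [set x | exists eta, dsum n eta <= x <= dsum n eta + c].

Lemma subset_thick c d n : c <= d -> thick c n `<=` thick d n.
Proof.
move=> cd x [eta /andP[ex xe]]; exists eta; rewrite ex/=.
by rewrite (le_trans xe)// lerD2l.
Qed.

Lemma thickS c n :
  thick c n.+1 = \bigcup_i [set x | thick c n (x - dig i * q ^+ n)].
Proof.
apply/seteqP; split=> x /=.
  move=> [eta]; rewrite dsumS => xe; exists (eta n) => //; exists eta.
  by rewrite lerBrDr lerBlDr addrAC.
move=> [i _ [eta xe]]; exists (splice n eta (fun=> i)).
rewrite dsum_rcons; move: xe => /andP[? ?]; apply/andP; split; lra.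
Qed.

Lemma finmeas_thick c n : I -> finmeas (thick c n).
Proof.
move=> i0; elim: n => [|n IH]; last first.
  by rewrite thickS; apply: finmeas_bigcup => i; exact: finmeas_translate.
suff -> : thick c 0 = `[0, c]%classic by exact: finmeas_itv.
apply/seteqP; split=> x /=; rewrite in_itv/=.
  by move=> [eta]; rewrite /dsum big_ord0 add0r.
by move=> xc; exists (fun=> i0); rewrite /dsum big_ord0 add0r.
Qed.

Hypothesis dig_itv : forall i, 0 <= dig i <= q.
Hypothesis I4 : (4 <= #|I|)%N.

Let q4 : 4 <= q. Proof. by rewrite ler_nat. Qed.
Let q_gt0 : 0 < q. Proof. by rewrite (lt_le_trans _ q4). Qed.
Let i0 : I.
Proof.
by apply: (enum_val (A := I)); exact: (Ordinal (ltnW (ltnW (ltnW I4)))).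
Qed.
Let fthick c n : finmeas (thick c n). Proof. exact: finmeas_thick. Qed.

Lemma le_len_thick c d n : c <= d -> len (thick c n) <= len (thick d n).
Proof.
by move=> cd; apply: le_len => //; [exact: (fthick _ _).1|exact: subset_thick].
Qed.

Lemma len_thickS_le c n : len (thick c n.+1) <= q * len (thick c n).
Proof.
rewrite {1}thickS.
have fT i : finmeas [set x | thick c n (x - dig i * q ^+ n)].
  exact: finmeas_translate.
apply: le_trans (le_len_bigcup fT _ _) _ => //; first exact: (finmeas_bigcup fT).1.
under eq_bigr do rewrite len_translate//.
by rewrite sumr_const mulr_natl.
Qed.

(** Grouping by the lowest digit: it lies between 0 and [q], so after division by [q] it moves a
    point by at most 1, while the width [c] becomes [c / q]. *)
Lemma len_thick_low c n :
  len (thick c n.+1) <= q * len (thick (1 + c / q) n).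
Proof.
rewrite -len_dilate//; apply: le_len; [exact: finmeas_dilate|exact: (fthick _ _).1|].
move=> x [eta]; rewrite dsumSl => /andP[ex xe]; exists (eta \o S).
have /andP[d0 d1] := dig_itv (eta 0%N).
rewrite mulrC ler_pdivlMr// ler_pdivrMr// !mulrDl divfK ?gt_eqF// mul1r.
rewrite (mulrC _ q); apply/andP; split; lra.
Qed.

(** Iterates the grouping. Widths of the form [2 + q ^+ j] persist: [1 + (2 + q ^+ j.+1) / q] is at
    most [2 + q ^+ j], since [q] is at least 4. *)
Lemma len_thick_lown j k :
  len (thick (2 + q ^+ j) (j + k)) <= q ^+ j * len (thick 3 k).
Proof.
elim: j => [|j IH].
  by rewrite !expr0 mul1r add0n; apply: le_len_thick; lra.
rewrite addSn exprS; apply: le_trans (len_thick_low _ _) _.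
rewrite -mulrA ler_pM2l//; apply: le_trans IH; apply: le_len_thick.
rewrite mulrDl mulrAC divff ?gt_eqF// mul1r addrA lerD2r -[leRHS]/(1 + 1) lerD2l.
by rewrite ler_pdivrMr// mul1r (le_trans _ q4)// ler_nat.
Qed.

(** This is (ii). Without such a pair the translates that make up level [n.+1] are disjoint and the
    measure grows by exactly [q], but [len_thick_low] bounds it by [q * len (thick 2 n)]. *)
Lemma exists_close_dsums n : exists eta zeta,
  eta n != zeta n /\ `|dsum n.+1 eta - dsum n.+1 zeta| <= q.
Proof.
apply: contrapT => far.
pose T i := [set x | thick q n (x - dig i * q ^+ n)].
have fT i : finmeas (T i) by exact: finmeas_translate.
have tT : trivIset setT T.
  apply/trivIsetP => i j _ _ ij; apply/seteqP; split=> // x [[eta ex] [zeta zx]].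
  apply: far; exists (splice n eta (fun=> i)), (splice n zeta (fun=> j)).
  split; first by rewrite /splice ltnn.
  rewrite !dsum_rcons ler_norml.
  move: ex zx => /andP[? ?] /andP[? ?]; apply/andP; split; lra.
have uS : len (thick q n.+1) = q * len (thick q n).
  rewrite thickS len_bigcup//; under eq_bigr do rewrite len_translate//.
  by rewrite sumr_const mulr_natl.
have := len_thick_low q n; rewrite uS.
rewrite divff ?gt_eqF// ler_pM2l// -[1 + 1]/2 leNgt => /negP; apply.
(* The number [t] below is the largest digit sum. The interval from [t + 3] to [t + q] lies in
   [thick q n], beyond all of [thick 2 n], and has positive length [q - 3]. *)
pose m : I := [arg max_(i > i0) dig i]%O.
have dm i : dig i <= dig m.
  by rewrite /m; case: Order.TotalTheory.arg_maxP => // j _ /(_ i); apply.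
have Dm eta : dsum n eta <= dsum n (fun=> m).
  by apply: ler_sum => j _; rewrite ler_wpM2r// exprn_ge0// ltW.
set t := dsum n (fun=> m) in Dm.
have fJ := finmeas_itv (t + 3) (t + q).
have : len (thick 2 n `|` `[t + 3, t + q]) <= len (thick q n).
  apply: le_len => //; first by apply: measurableU; [exact: (fthick _ _).1|exact: fJ.1].
  move=> x [/subset_thick|]; first by apply; rewrite (le_trans _ q4)// ler_nat.
  rewrite /= in_itv/= => /andP[? ?]; exists (fun=> m); rewrite -/t.
  by apply/andP; split; lra.
have := lenUI (fthick 2 n) fJ.
have -> : thick 2 n `&` `[t + 3, t + q]%classic = set0.
  apply/seteqP; split=> // x [[eta /andP[? ?]]]; rewrite /= in_itv/= => /andP[? ?].
  have := Dm eta; lra.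
rewrite len0 addr0 => ->; rewrite len_itv; last by move: q4; lra.
move: q4; lra.
Qed.

(** Subadditivity over the leading digits, improved by the overlap of two pieces. This overlap
    contains that of two translates of [thick q m] whose union fits into one translate of
    [thick c m], so inclusion-exclusion bounds it from below. *)
Lemma len_thick_overlap (m n : nat) eta zeta (c : R) : eta n != zeta n ->
  q + `|dsum n.+1 eta - dsum n.+1 zeta| * q ^+ m <= c ->
  len (thick q (m + n).+1) + 2 * len (thick q m) <=
    q * len (thick q (m + n)) + len (thick c m).
Proof.
move=> neq cE; pose N := (m + n)%N.
pose T i := [set x | thick q N (x - dig i * q ^+ N)].
have fT i : finmeas (T i) by exact: finmeas_translate.
have lT i : len (T i) = len (thick q N) by rewrite len_translate.
set i := eta n in neq; set j := zeta n in neq.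
have fI : finmeas (T i `&` T j).
  by apply: (finmeas_sub (fT i)) => //; apply: measurableI; exact: (fT _).1.
have fD : finmeas (T i `\` T j).
  by apply: (finmeas_sub (fT i)) => //; apply: measurableD; exact: (fT _).1.
have lN : len (thick q N.+1) <= q * len (thick q N) - len (T i `&` T j).
  (* Removing [T j] from [T i] counts the overlap only once. *)
  pose B k := if k == i then T i `\` T j else T k.
  have fB k : finmeas (B k) by rewrite /B; case: ifP.
  have := le_len_bigcup fB (fthick q N.+1).1.
  rewrite (bigD1 i)//= {2}/B eqxx lenD// lT.
  under eq_bigr => k /negbTE ki do rewrite /B ki lT.
  have : \sum_(k : I) len (thick q N) = q * len (thick q N).
    by rewrite sumr_const mulr_natl.
  rewrite (bigD1 i)//= => <-; rewrite [leRHS]addrAC; apply.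
  rewrite thickS => x [k _ kx]; have [xj|xj] := pselect (T j x).
    by exists j => //; rewrite /B eq_sym (negbTE neq).
  exists k => //; rewrite /B; case: ifP => // /eqP ki; split=> //.
  by rewrite -ki.
pose X (e : nat -> I) := [set x | thick q m (x - dsum n.+1 e * q ^+ m)].
have fX e : finmeas (X e) by exact: finmeas_translate.
have lX e : len (X e) = len (thick q m) by rewrite len_translate.
have XT e : X e `<=` T (e n).
  move=> x [ze xz]; exists (splice m ze e); rewrite dsum_splice.
  by move: xz; rewrite dsumS /N exprD => /andP[? ?]; apply/andP; split; lra.
have lI : len (X eta `&` X zeta) <= len (T i `&` T j).
  apply: le_len => //; first by apply: measurableI; exact: (fX _).1.
  by move=> x [/XT ? /XT ?].
have lU : len (X eta `|` X zeta) <= len (thick c m).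
  (* The smaller of the two offsets; the larger one exceeds it by at most [c - q]. *)
  pose s := Num.min (dsum n.+1 eta) (dsum n.+1 zeta) * q ^+ m.
  rewrite -(len_translate s (fthick c m)).
  apply: le_len; [exact: finmeas_translate|by apply: measurableU; exact: (fX _).1|].
  have qm : 0 < q ^+ m by rewrite exprn_gt0.
  have bounds (a b : R) : q + `|a - b| * q ^+ m <= c ->
      let s := Num.min a b * q ^+ m in
      (s <= a * q ^+ m <= s + (c - q)) && (s <= b * q ^+ m <= s + (c - q)).
    rewrite /= /Num.min; case: ltP => ab.
      rewrite distrC gtr0_norm ?subr_gt0// => ?.
      have : a * q ^+ m <= b * q ^+ m by rewrite ler_pM2r// ltW.
      by move=> ?; apply/andP; split; apply/andP; split; lra.
    rewrite ger0_norm ?subr_ge0// => ?.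
    have : b * q ^+ m <= a * q ^+ m by rewrite ler_pM2r.
    by move=> ?; apply/andP; split; apply/andP; split; lra.
  have /andP[/andP[? ?] /andP[? ?]] := bounds _ _ cE; rewrite {}/s.
  by move=> x [|] [ze /andP[? ?]]; exists ze; apply/andP; split; lra.
by have := lenUI (fX eta) (fX zeta); rewrite !lX; lra.
Qed.

(** This is (i). The normalized measures [a m] are nonincreasing, and their infimum [kappa] plays
    the part of |K|. If it is positive, the overlap inequality fails at levels where [a] is close to
    [kappa]. *)
Lemma len_thick_small : (forall e, 0 < e -> exists n eta zeta,
    eta n != zeta n /\ `|dsum n.+1 eta - dsum n.+1 zeta| < e) ->
  forall e, 0 < e -> exists m, len (thick q m) < e * q ^+ m.
Proof.
move=> close e e0; apply: contrapT => big.
have qn n : 0 < q ^+ n by rewrite exprn_gt0.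
pose a m := len (thick q m) / q ^+ m.
have aE m : len (thick q m) = a m * q ^+ m by rewrite divfK ?gt_eqF.
have ea m : e <= a m.
  rewrite leNgt; apply/negP => am; apply: big; exists m.
  by rewrite aE ltr_pM2r.
have aS m : a m.+1 <= a m.
  rewrite -(ler_pM2r (qn m.+1)) -aE (le_trans (len_thickS_le _ _))//.
  by rewrite exprS mulrCA -aE.
have anoninc m n : a (n + m)%N <= a m.
  by elim: n => // n IH; rewrite addSn (le_trans (aS _)).
pose A := range a.
have hA : has_inf A.
  by split; [exists (a 0%N), 0%N|exists e => _ [m _ <-]].
pose kappa := inf A.
have k0 : 0 < kappa.
  apply: lt_le_trans e0 _; apply: lb_le_inf; first by case: hA.
  by move=> _ [m _ <-].
have ka m : kappa <= a m by apply: ge_inf; [case: hA|exists m].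
have [_ [k _ <-] ak] := inf_adherent (divr_gt0 k0 (ltr0n R 4)) hA.
(* Multiplied by [q ^+ (j + k)], this distance becomes [q ^+ j / 2]. *)
have ek0 : 0 < (q ^+ k)^-1 / 2 by rewrite divr_gt0// invr_gt0.
have [n [eta [zeta [neq near]]]] := close _ ek0.
pose delta := kappa / 2 / q ^+ n.+1.
have d0 : 0 < delta by rewrite !divr_gt0.
have [_ [N _ <-] aN] := inf_adherent d0 hA.
(* That [j] is at least 2 gives [q + q ^+ j / 2 <= 2 + q ^+ j]; that it is at least [N] brings
   [a (m + n)] within [delta] of [kappa]. *)
pose j := N.+2; pose m := (j + k)%N.
have cE : q + `|dsum n.+1 eta - dsum n.+1 zeta| * q ^+ m <= 2 + q ^+ j.
  have : `|dsum n.+1 eta - dsum n.+1 zeta| * q ^+ m <= q ^+ j / 2.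
    rewrite /m exprD mulrCA ler_pM2l// -ler_pdivlMr// mulrC.
    exact: ltW.
  have : q * 4 <= q ^+ j.
    rewrite exprS ler_pM2l// (le_trans q4)// exprS ler_peMr//.
    by rewrite exprn_ege1// (le_trans _ q4)// ler1n.
  move: q4; lra.
have := len_thick_overlap neq cE.
have := len_thick_lown j k; rewrite -/m => low.
have := @le_len_thick 3 q k; rewrite (le_trans _ q4) ?ler_nat// => /(_ isT) low'.
have {low low'} low : len (thick (2 + q ^+ j) m) <= a k * q ^+ m.
  apply: le_trans low _; rewrite /m exprD mulrCA ler_pM2l//.
  by rewrite -aE.
have aN' : a (m + n)%N < kappa + delta.
  apply: le_lt_trans aN; have -> : (m + n = (k + n + 2) + N)%N by rewrite /m /j; lia.
  exact: anoninc.
have -> : len (thick q (m + n).+1) = a (m + n.+1)%N * q ^+ n.+1 * q ^+ m.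
  by rewrite -addnS aE exprD -mulrA (mulrC (q ^+ m)).
have -> : q * len (thick q (m + n)) = a (m + n)%N * q ^+ n.+1 * q ^+ m.
  by rewrite aE exprD exprS; ring.
rewrite (aE m) => ov.
have {ov} : (a (m + n.+1)%N * q ^+ n.+1 + 2 * a m) * q ^+ m <=
    (a (m + n)%N * q ^+ n.+1 + a k) * q ^+ m by lra.
(* The left side is at least [kappa * q ^+ n.+1 + 2 * kappa], whereas the right side exceeds
   [kappa * q ^+ n.+1] by less than [kappa / 2 + 5 * kappa / 4]. *)
rewrite ler_pM2r// leNgt => /negP; apply.
have dq : delta * q ^+ n.+1 = kappa / 2 by rewrite divfK ?gt_eqF.
have h1 : a (m + n)%N * q ^+ n.+1 <= (kappa + delta) * q ^+ n.+1.
  by rewrite ler_pM2r// ltW.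
have h2 : kappa * q ^+ n.+1 <= a (m + n.+1)%N * q ^+ n.+1 by rewrite ler_pM2r.
have := ka m; lra.
Qed.

End digit_sums.

(** * Horizontal slices *)

Lemma natr_gtr_dist (R : realType) (a b : nat) : a <> b ->
  1 <= `|a%:R - b%:R : R|.
Proof.
move=> ab; wlog lt : a b ab / (b < a)%N.
  move=> W; case: (ltngtP a b) => [lt|lt|//]; last exact: W.
  by rewrite distrC; apply: W => //; exact/nesym.
by rewrite -natrB ?(ltnW lt)// normr_nat ler1n subn_gt0.
Qed.

Section slices.
Context (R : realType) (r : nat).
Hypothesis r2 : (2 <= r)%N.

Local Notation I := ('I_r * 'I_r)%type.
Local Notation q := (#|{: I}|%:R : R).

Let rR : 2 <= r%:R :> R. Proof. by rewrite ler_nat. Qed.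

Lemma card_digit_pairs : q = r%:R * r%:R.
Proof. by rewrite card_prod !card_ord natrM. Qed.

Lemma card_digit_pairs_ge4 : (4 <= #|{: I}|)%N.
Proof. by rewrite card_prod !card_ord; exact: (leq_mul r2 r2). Qed.

Definition fst_dig (i : I) : R := (i.1 : nat)%:R.
Definition snd_dig (i : I) : R := (i.2 : nat)%:R.
(** The first digit of the pair belongs to the point of E, the second to the point of E'. There are
    [r * r] pairs, as many as the base, so [dsum] applies. *)
Definition slice_dig (h : R) (i : I) : R :=
  (1 - h) * fst_dig i + h * (r%:R * snd_dig i).

Let digr (i : 'I_r) : 0 <= ((i : nat)%:R : R) <= r%:R - 1.
Proof. by rewrite ler0n lerBrDr natr1 ler_nat ltn_ord. Qed.

Lemma slice_dig_itv (h : R) i : 0 <= h <= 1 -> 0 <= slice_dig h i <= q.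
Proof.
move=> /andP[h0 h1]; rewrite card_digit_pairs /slice_dig /fst_dig /snd_dig.
have /andP[a0 a1] := digr i.1; have /andP[b0 b1] := digr i.2.
apply/andP; split; first by rewrite addr_ge0// mulr_ge0 ?subr_ge0// mulr_ge0.
have : (1 - h) * (i.1 : nat)%:R <= (1 - h) * (r%:R * r%:R).
  rewrite ler_wpM2l ?subr_ge0// (le_trans a1)//.
  have : r%:R * 2 <= r%:R * r%:R :> R by rewrite ler_wpM2l.
  by move: rR; lra.
have : h * (r%:R * (i.2 : nat)%:R) <= h * (r%:R * r%:R).
  by rewrite ler_wpM2l// ler_wpM2l//; lra.
lra.
Qed.

Lemma dsum_slice h n eta : dsum (slice_dig h) n eta =
  (1 - h) * dsum fst_dig n eta + h * (r%:R * dsum snd_dig n eta).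
Proof.
rewrite /dsum !mulr_sumr -big_split/=; apply: eq_bigr => j _.
by rewrite /slice_dig; ring.
Qed.

(** The induction rests on [r - 1 + 1/2 <= q / 2], which is the nonnegativity of the square of
    [r - 1]. *)
Lemma dsum_digit_bound (d : I -> 'I_r) n eta :
  0 <= dsum (fun i => (d i : nat)%:R : R) n eta <= q ^+ n / 2.
Proof.
elim: n => [|n /andP[IH0 IH1]]; first by rewrite /dsum big_ord0 expr0; lra.
have qn : 0 < q ^+ n by rewrite exprn_gt0// ltr0n (leq_trans _ card_digit_pairs_ge4).
rewrite dsumS; have /andP[d0 d1] := digr (d (eta n)).
apply/andP; split; first by rewrite addr_ge0// mulr_ge0// ltW.
have : (d (eta n) : nat)%:R * q ^+ n <= (r%:R - 1) * q ^+ n by rewrite ler_pM2r.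
have : (r%:R - 1 + 2^-1) * q ^+ n <= q / 2 * q ^+ n.
  rewrite ler_pM2r// card_digit_pairs.
  by have := sqr_ge0 (r%:R - 1 : R); rewrite expr2; lra.
by rewrite exprS; lra.
Qed.

(** The leading digits contribute at least [q ^+ n], and the lower digits can cancel at most half of
    this. *)
Lemma dsum_lead_dist (d : I -> 'I_r) n eta zeta : d (eta n) <> d (zeta n) ->
  q ^+ n / 2 <= `|dsum (fun i => (d i : nat)%:R : R) n.+1 eta -
                  dsum (fun i => (d i : nat)%:R : R) n.+1 zeta|.
Proof.
move=> ne; rewrite !dsumS.
have qn : 0 < q ^+ n by rewrite exprn_gt0// ltr0n (leq_trans _ card_digit_pairs_ge4).
have /andP[a0 a1] := dsum_digit_bound d n eta.
have /andP[b0 b1] := dsum_digit_bound d n zeta.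
set a := dsum _ n eta in a0 a1 *; set b := dsum _ n zeta in b0 b1 *.
set x : R := (d (eta n) : nat)%:R; set y : R := (d (zeta n) : nat)%:R.
have xy : 1 <= `|x - y| by apply: natr_gtr_dist => /val_inj.
have : q ^+ n <= `|x - y| * q ^+ n by rewrite ler_peMl// ltW.
have -> : `|x - y| * q ^+ n = `|(x - y) * q ^+ n|.
  by rewrite normrM (gtr0_norm qn).
have -> : a + x * q ^+ n - (b + y * q ^+ n) = (a - b) + (x - y) * q ^+ n by ring.
have : `|a - b| <= q ^+ n / 2 by rewrite ler_norml; apply/andP; split; lra.
move=> h1 h2; have := lerB_dist ((x - y) * q ^+ n) (- (a - b)).
rewrite opprK normrN [_ + (a - b)]addrC; lra.
Qed.

(** The heights at which the hypothesis of [len_thick_small] holds for the tolerance [e]. *)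
Definition close_set (e : R) : set R :=
  [set h | exists n eta zeta, eta n != zeta n /\
    `|dsum (slice_dig h) n.+1 eta - dsum (slice_dig h) n.+1 zeta| < e].

(** For fixed digit strings the difference is affine in [h], so each condition is open. *)
Lemma open_close_set e : open (close_set e).
Proof.
have -> : close_set e = \bigcup_(t in [set t : nat * (nat -> I) * (nat -> I) |
      t.1.2 t.1.1 != t.2 t.1.1])
    [set h | `|dsum (slice_dig h) t.1.1.+1 t.1.2
             - dsum (slice_dig h) t.1.1.+1 t.2| < e].
  apply/seteqP; split=> h /=.
    by move=> [n [eta [zeta [? ?]]]]; exists (n, eta, zeta).
  by move=> [[[n eta] zeta] /= ? ?]; exists n, eta, zeta.
apply: bigcup_open => -[[n eta] zeta] _ /=.
pose f h := `|dsum (slice_dig h) n.+1 eta - dsum (slice_dig h) n.+1 zeta|.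
have cf : continuous f.
  move=> h; rewrite /f; apply: cvg_norm; move: h.
  change (continuous (fun h =>
    dsum (slice_dig h) n.+1 eta - dsum (slice_dig h) n.+1 zeta)).
  have -> : (fun h => dsum (slice_dig h) n.+1 eta - dsum (slice_dig h) n.+1 zeta) =
     (fun h => (dsum fst_dig n.+1 eta - dsum fst_dig n.+1 zeta) * (1 - h) +
      (r%:R * (dsum snd_dig n.+1 eta - dsum snd_dig n.+1 zeta)) * h).
    by apply/funext => x; rewrite !dsum_slice; ring.
  by move=> h; apply: cvgD; apply: cvgM;
    [exact: cvg_cst|apply: cvgB; [exact: cvg_cst|exact: cvg_id]
    |exact: cvg_cst|exact: cvg_id].
have -> : [set h | f h < e] = f @^-1` [set x | x < e] by [].
apply: open_comp; first by move=> x _; exact: cf.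
exact: open_lt.
Qed.

(** This is (iii): [c] is the zero of the affine difference [dA + t * P], and [p] is the absolute
    value of its slope. *)
Lemma close_set_hole (e h s : R) : 0 < e -> 0 < s -> 0 <= h <= 1 ->
  exists (c p : R), [/\ 0 < p, (q + e) / p < s, `|c - h| <= q / p &
    ball c (e / p) `<=` close_set e].
Proof.
move=> e0 s0 /andP[h0 h1].
have q0 : 0 < q by rewrite ltr0n (leq_trans _ card_digit_pairs_ge4).
(* Chosen so that [q ^+ n > M] and the estimate [big] below give [(q + e) / s < |P|]. *)
pose M := 2 * (q + 2 * ((q + e) / s)).
have qes : 0 <= (q + e) / s by apply: divr_ge0; [apply: addr_ge0|]; exact: ltW.
have M0 : 0 <= M by rewrite /M; lra.
pose n := Num.bound M.
have qM : M < q ^+ n.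
  apply: lt_le_trans (archi_boundP M0) _; rewrite -natrX ler_nat.
  by apply/ltnW/ltn_expl; exact: leq_trans card_digit_pairs_ge4.
have hd i : 0 <= slice_dig h i <= q by apply: slice_dig_itv; rewrite h0.
have [eta [zeta [ne close]]] :=
  exists_close_dsums hd card_digit_pairs_ge4 n.
pose dA := dsum fst_dig n.+1 eta - dsum fst_dig n.+1 zeta.
pose dB := dsum snd_dig n.+1 eta - dsum snd_dig n.+1 zeta.
pose P := r%:R * dB - dA.
have fE t : dsum (slice_dig t) n.+1 eta - dsum (slice_dig t) n.+1 zeta = dA + t * P.
  by rewrite !dsum_slice /P /dA /dB; ring.
rewrite fE in close.
(* A value of size at most [q] at one [h] in the unit interval bounds [dA], and then [dB], by the
   slope. *)
have hP : `|h * P| <= `|P| by rewrite normrM ger0_norm// ler_piMl.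
have dAP : `|dA| <= q + `|P|.
  have := ler_normB (dA + h * P) (h * P); rewrite addrK; lra.
have dBP : `|dB| <= q + 2 * `|P|.
  have := ler_normD P dA; rewrite /P subrK normrM ger0_norm//.
  have : `|dB| <= r%:R * `|dB| by rewrite ler_peMl// (le_trans _ rR)// ler1n.
  rewrite -/P; lra.
(* The leading pairs differ in some coordinate, which makes [dA] or [dB] large. *)
have big : q ^+ n / 2 <= q + 2 * `|P|.
  have [e1|ne1] := pselect ((eta n).1 = (zeta n).1).
    have ne2 : (eta n).2 <> (zeta n).2.
      move=> e2; move/eqP: ne; apply.
      by case: (eta n) (zeta n) e1 e2 => ? ? [? ?] /= -> ->.
    by apply: le_trans dBP; exact: (dsum_lead_dist (d := snd)).
  apply: (@le_trans _ _ `|dA|); first exact: (dsum_lead_dist (d := fst)).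
  by have := normr_ge0 P; lra.
have Pbig : (q + e) / s < `|P| by move: qM; rewrite /M; lra.
have P0 : 0 < `|P| by exact: le_lt_trans qes Pbig.
have Pn0 : P != 0 by rewrite -normr_gt0.
exists (- dA / P), `|P|; split=> //.
- by rewrite ltr_pdivrMr// mulrC -ltr_pdivrMr.
- have -> : - dA / P - h = - (dA + h * P) / P by field.
  by rewrite normrM normrN normfV ler_pM2r ?invr_gt0.
- move=> t; rewrite -ball_normE /= => tc; exists n, eta, zeta; split=> //.
  rewrite fE; have -> : dA + t * P = (- (- dA / P - t)) * P by field.
  by rewrite normrM normrN -ltr_pdivlMr.
Qed.

End slices.

(** * Porous sets and the Lebesgue density theorem *)

Lemma finmeas_ball (R : realType) (c s : R) : 0 <= s -> finmeas (ball c s).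
Proof.
by move=> s0; split; [exact: measurable_ball|rewrite lebesgue_measure_ball// ltry].
Qed.

Lemma len_ball (R : realType) (c s : R) : 0 <= s -> len (ball c s) = 2 * s.
Proof. by move=> s0; rewrite /len lebesgue_measure_ball//= mulr_natl. Qed.

(** The ball of radius [(b + a) / p] about [x] contains the hole, which fills the fixed fraction
    [a / (b + a)] of it. This happens at arbitrarily small radii, so [x] is a point of [A] where the
    density is not 1. *)
Lemma negligible_porous (R : realType) (A D : set R) (a b : R) : measurable A ->
  0 < a -> 0 <= b -> D `<=` A ->
  (forall x, D x -> forall s, 0 < s -> exists c p, [/\ 0 < p,
     (b + a) / p < s, `|c - x| <= b / p & ball c (a / p) `<=` ~` A]) ->
  (@lebesgue_measure R).-negligible D.
Proof.
move=> mA a0 b0 DA hole; apply: negligibleS (lebesgue_density mA).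
move=> x Dx /= dens.
have a1 : 0 < b + a by rewrite ltr_wpDl.
pose k := 1 - a / (b + a).
have k1 : k < 1 by rewrite /k ltrBlDr ltrDl divr_gt0.
have /dens : nbhs ((\1_A x)%:E : \bar R) [set y | (k%:E < y)%E].
  apply: open_nbhs_nbhs; split; first exact: open_ereal_gt_ereal.
  by rewrite /= indicE mem_set ?lte_fin//; exact: DA.
move=> [s /= s0 sk].
have [c [p [p0 ps cx bA]]] := hole _ Dx _ s0.
pose t := (b + a) / p.
have t0 : 0 < t by rewrite divr_gt0.
have := sk t; rewrite /ball_ /= sub0r normrN gtr0_norm// => /(_ ps t0).
have t2 : 0 < 2 * t by rewrite mulr_gt0.
have fB := finmeas_ball x (ltW t0).
have e0 : 0 < a / p by rewrite divr_gt0.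
have fb := finmeas_ball c (ltW e0).
have bB : ball c (a / p) `<=` ball x t.
  move=> z; rewrite -!ball_normE /= => cz.
  have := ler_distD c x z; rewrite (distrC x c) /t mulrDl; lra.
have fA : finmeas (A `&` ball x t).
  by apply: (finmeas_sub fB) => //; apply: measurableI => //; exact: fB.1.
rewrite (lenE fA) (lenE fB) len_ball ?(ltW t0)// inver gt_eqF//.
rewrite -EFinM lte_fin (ltr_pdivlMr _ _ t2) ltNge => /negP; apply.
have : len (A `&` ball x t) <= len (ball x t `\` ball c (a / p)).
  apply: le_len; [|exact: fA.1|].
    apply: (finmeas_sub fB) => //; apply: measurableD; [exact: fB.1|exact: fb.1].
  by move=> z [Az Bz]; split=> // /bA.
rewrite lenD// (setIidr bB) !len_ball ?(ltW e0) ?(ltW t0)// => /le_trans; apply.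
have -> : a / p = a / (b + a) * t by rewrite /t; field; rewrite !lt0r_neq0.
by rewrite /k; lra.
Qed.

Section almost_every_slice.
Context (R : realType) (r : nat).
Hypothesis r2 : (2 <= r)%N.

Local Notation I := ('I_r * 'I_r)%type.
Local Notation q := (#|{: I}|%:R : R).

Lemma negligible_not_close (e : R) : 0 < e -> (@lebesgue_measure R).-negligible
  [set h | 0 <= h <= 1 /\ ~ close_set r e h].
Proof.
move=> e0; apply: (@negligible_porous _ (~` close_set r e) _ e q) => //.
- by apply: measurableC; apply: open_measurable; exact: open_close_set.
- by move=> h [].
- move=> h [h01 _] s s0; rewrite setCK; exact: (close_set_hole r2 e0 s0 h01).
Qed.

(** Nullity of the slice at height [h], expressed through its coverings. *)
Definition small_slice (h : R) : Prop := forall e : R, 0 < e ->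
  exists m, len (thick (slice_dig h : I -> R) q m) < e * q ^+ m.

Lemma negligible_not_small_slice : (@lebesgue_measure R).-negligible
  [set h | 0 <= h <= 1 /\ ~ small_slice h].
Proof.
(* Tolerances [1 / (k + 1)] suffice and make the exceptional set a countable union. *)
pose bad k := [set h : R | 0 <= h <= 1 /\ ~ close_set r k.+1%:R^-1 h].
have : (@lebesgue_measure R).-negligible (\bigcup_k bad k).
  by apply: negligible_bigcup => k; apply: negligible_not_close; rewrite invr_gt0.
apply: negligibleS.
move=> h [h01 ns]; apply: contrapT => nb; apply: ns.
apply: len_thick_small => //; first by move=> i; exact: slice_dig_itv.
  exact: card_digit_pairs_ge4.
move=> e e0; have [k ke] : exists k : nat, k.+1%:R^-1 < e.
  exists (Num.bound e^-1); rewrite invf_plt ?posrE//.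
  apply: lt_trans (archi_boundP _) _; first by rewrite invr_ge0 ltW.
  by rewrite ltr_nat.
have [n [eta [zeta [ne ce]]]] : close_set r k.+1%:R^-1 h.
  by apply: contrapT => nc; apply: nb; exists k.
by exists n, eta, zeta; split=> //; exact: lt_trans ce ke.
Qed.

End almost_every_slice.

(** * The plane *)

(** Tonelli: by uniqueness the product measure equals the one that integrates over horizontal
    sections, and that integrand vanishes almost everywhere. *)
Lemma product_negligible (R : realType) (A : set (R * R)) : measurable A ->
  (@lebesgue_measure R).-negligible
    [set y | lebesgue_measure (ysection A y) <> 0%E] ->
  (@lebesgue_measure R \x @lebesgue_measure R)%E A = 0%E.
Proof.
move=> mA nA.
have -> : (@lebesgue_measure R \x @lebesgue_measure R)%E A =
          (@lebesgue_measure R \x^ @lebesgue_measure R)%E A.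
  apply: product_measure_unique => // B C mB mC; exact: product_measure2E.
rewrite /product_measure2.
rewrite (@ge0_ae_eq_integral _ _ _ (@lebesgue_measure R) setT _ (cst 0%E))//.
- by rewrite integral0.
- exact: measurable_fun_ysection.
- apply: negligibleS nA => y /= ny y0; apply: ny => _; exact: y0.
Qed.

Section plane.
Context (R : realType) (r : nat).
Hypothesis r2 : (2 <= r)%N.

Local Notation I := ('I_r * 'I_r)%type.
Local Notation q := (#|{: I}|%:R : R).

Lemma measurable_slice_dig (i : I) :
  measurable_fun setT (fun p : R * R => slice_dig p.2 i).
Proof.
apply: measurable_funD; apply: measurable_funM => //.
exact: measurable_funB.
Qed.

Definition thick2 (c : R) (m : nat) : set (R * R) :=
  [set p | thick (slice_dig p.2 : I -> R) c m p.1].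

(** Splitting off the leading digit gives a finite union of preimages under the measurable maps
    [f i]. *)
Lemma measurable_thick2 c m : measurable (thick2 c m).
Proof.
elim: m => [|m IH].
  have -> : thick2 c 0 = `[0, c]%classic `*` setT.
    apply/seteqP; split=> -[x y]; rewrite /thick2 /thick /= in_itv/= /dsum.
      by move=> [eta]; rewrite big_ord0 add0r.
    move=> [xc _]; exists (fun=> (Ordinal (ltnW r2), Ordinal (ltnW r2))).
    by rewrite big_ord0 add0r.
  by apply: measurableX => //; exact: measurable_itv.
pose f i (p : R * R) := (p.1 - slice_dig p.2 (i : I) * q ^+ m, p.2).
have -> : thick2 c m.+1 = \bigcup_i (f i @^-1` thick2 c m).
  by apply/seteqP; split=> -[x y]; rewrite /thick2/= thickS.
apply: fin_bigcup_measurable => // i _.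
have mf : measurable_fun setT (f i).
  apply: measurable_fun_pair; last exact: measurable_snd.
  apply: measurable_funB; first exact: measurable_fst.
  by apply: measurable_funM => //; exact: measurable_slice_dig.
by rewrite -[X in measurable X]setTI; exact: mf.
Qed.

(** The covering of B at level [m], with the dilation by [q ^+ m] undone. *)
Definition cover2 (m : nat) : set (R * R) :=
  [set p | 0 <= p.2 <= 1 /\ thick (slice_dig p.2 : I -> R) q m (q ^+ m * p.1)].

Lemma measurable_cover2 m : measurable (cover2 m).
Proof.
pose f (p : R * R) := (q ^+ m * p.1, p.2).
have -> : cover2 m = (setT `*` `[0, 1]%classic) `&` (f @^-1` thick2 q m).
  apply/seteqP; split=> -[x y]; rewrite /cover2 /thick2 /= in_itv/=.
    by move=> [? ?].
  by move=> [[_ ?] ?].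
apply: measurableI; first by apply: measurableX => //; exact: measurable_itv.
have mf : measurable_fun setT f.
  apply: measurable_fun_pair; last exact: measurable_snd.
  by apply: measurable_funM => //; exact: measurable_fst.
by rewrite -[X in measurable X]setTI; apply: mf => //; exact: measurable_thick2.
Qed.

Lemma cover2_null :
  (@lebesgue_measure R \x @lebesgue_measure R)%E (\bigcap_m cover2 m) = 0%E.
Proof.
have mC : measurable (\bigcap_m cover2 m).
  by apply: bigcapT_measurable => m; exact: measurable_cover2.
apply: product_negligible => //.
apply: negligibleS (negligible_not_small_slice R r2) => y /= yn.
(* At other heights the section is empty. *)
have y01 : 0 <= y <= 1.
  apply: contrapT => ny; apply: yn.
  rewrite (_ : ysection _ _ = set0) ?measure0//.
  apply/seteqP; split=> // x; rewrite /ysection /= inE => /(_ 0%N Logic.I) [/=].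
  by move/ny.
split=> // sm; apply: yn.
apply/eqP; rewrite -measure_le0; apply/lee_addgt0Pr => e e0.
rewrite add0e; have [m me] := sm e e0.
have qm : 0 < q ^+ m by rewrite exprn_gt0// ltr0n (leq_trans _ (card_digit_pairs_ge4 r2)).
have fT : finmeas (thick (slice_dig y : I -> R) q m).
  by apply: finmeas_thick; exact: (Ordinal (ltnW r2), Ordinal (ltnW r2)).
have fA := finmeas_affine_preimage 0 qm fT.
have mY : measurable (ysection (\bigcap_m cover2 m) y) by exact: measurable_ysection.
apply: (@le_trans _ _ (lebesgue_measure
  [set x | thick (slice_dig y : I -> R) q m (q ^+ m * x + 0)])).
  apply: le_measure; rewrite ?inE//; first exact: fA.1.
  move=> x; rewrite /ysection /= inE => /(_ m Logic.I) [/= _].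
  by rewrite addr0.
rewrite lenE// lee_fin -(ler_pM2l qm) -len_affine_preimage// mulrC.
exact: ltW.
Qed.

End plane.

(** * Partial sums of the digit series and the covering of B *)

Section digit_series.
Context (R : realType) (r : nat).
Hypothesis r2 : (2 <= r)%N.

Local Notation I := ('I_r * 'I_r)%type.
Local Notation q := (#|{: I}|%:R : R).

Definition psum (eta : nat -> 'I_r) (n : nat) : R :=
  \sum_(1 <= j < n.+1) (eta j)%:R * (r%:R : R) ^- (2 * j).

Let q_ge4 : 4 <= q.
Proof. by rewrite ler_nat; exact: card_digit_pairs_ge4. Qed.

Let qn_gt0 n : 0 < q ^+ n.
Proof. by rewrite exprn_gt0// (lt_le_trans _ q_ge4). Qed.

Lemma psumS eta n : psum eta n.+1 = psum eta n + (eta n.+1)%:R / q ^+ n.+1.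
Proof.
by rewrite /psum big_nat_recr//= exprM expr2 -card_digit_pairs.
Qed.

Lemma psum0 eta : psum eta 0 = 0.
Proof. by rewrite /psum big_geq. Qed.

(** Telescoping: the term at [k.+1] is at most the difference of the inverses of [q ^+ k] and
    [q ^+ k.+1]. The subtracted last term makes the induction close. *)
Lemma psum_le eta m n :
  psum eta m <= psum eta (m + n) <= psum eta m + (q ^+ m)^-1 - (q ^+ (m + n))^-1.
Proof.
elim: n => [|n /andP[IH0 IH1]]; first by rewrite addn0 addrK lexx.
rewrite addnS psumS; set k := (m + n)%N in IH0 IH1 *.
apply/andP; split; first by rewrite (le_trans IH0)// lerDl divr_ge0// ltW.
have : (eta k.+1)%:R / q ^+ k.+1 <= (q - 1) / q ^+ k.+1.
  rewrite ler_pM2r ?invr_gt0// lerBrDr natr1 ler_nat.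
  rewrite card_prod card_ord (leq_trans (ltn_ord _))//.
  by rewrite leq_pmulr// ltnW.
have -> : (q - 1) / q ^+ k.+1 = (q ^+ k)^-1 - (q ^+ k.+1)^-1.
  by rewrite exprS; field; rewrite !lt0r_neq0// (lt_le_trans _ q_ge4).
lra.
Qed.

Lemma nondecreasing_psum eta : nondecreasing_seq (psum eta).
Proof.
by move=> m n mn; rewrite -(subnKC mn); have /andP[] := psum_le eta m (n - m).
Qed.

Lemma psum_ub eta m n : psum eta n <= psum eta m + (q ^+ m)^-1.
Proof.
have [mn|nm] := leqP m n.
  rewrite -(subnKC mn); have /andP[_] := psum_le eta m (n - m).
  by move/le_trans; apply; rewrite gerBl invr_ge0 ltW.
apply: (le_trans (nondecreasing_psum eta (ltnW nm))).
by rewrite lerDl invr_ge0 ltW.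
Qed.

Lemma is_cvg_psum eta : cvgn (psum eta).
Proof.
apply: nondecreasing_is_cvgn; first exact: nondecreasing_psum.
by exists (psum eta 0 + (q ^+ 0)^-1) => _ [n _ <-]; exact: psum_ub.
Qed.

Lemma psum_lim eta (x : R) m : psum eta @ \oo --> x ->
  psum eta m <= x <= psum eta m + (q ^+ m)^-1.
Proof.
move=> ex; have <- := cvg_lim (@Rhausdorff R) ex.
apply/andP; split.
  by apply: (@nondecreasing_cvgn_le R (psum eta));
    [exact: nondecreasing_psum|exact: is_cvg_psum].
by apply: limr_le; [exact: is_cvg_psum|apply: nearW => n; exact: psum_ub].
Qed.

(** [dsum] takes the lowest digit first, [psum] the leading one and numbers from 1; hence the index
    [m - j]. *)
Lemma dsum_rev (d : I -> 'I_r) (z : nat -> I) m :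
  dsum (fun i => (d i)%:R : R) m (fun j => z (m - j)%N) =
  q ^+ m * psum (d \o z) m.
Proof.
elim: m => [|m IH]; first by rewrite psum0 mulr0 /dsum big_ord0.
rewrite dsumSl psumS subn0.
rewrite (@eq_dsum _ _ _ m _ (fun j => z (m - j)%N)); last first.
  by move=> j _ /=; rewrite subSS.
rewrite IH mulrDr exprS mulrA addrC; congr (_ + _).
by rewrite mulrCA divff ?mulr1// mulf_neq0// ?lt0r_neq0// (lt_le_trans _ q_ge4).
Qed.

(** Comparing imaginary parts identifies [h] with the height [y]. *)
Lemma segment_unionE (x y : R) :
  plane_of (segment_union (@setE R r) (@setE' R r)) (x, y) <->
  exists e e', [/\ @digit_set R r e, @digit_set R r e', 0 <= y <= 1 &
    x = (1 - y) * e + y * (r%:R * e')].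
Proof.
have rC : r%:R = (r%:R : R)%:C :> R[i] by rewrite rmorph_nat.
rewrite /plane_of /segment_union /=; split.
  move=> [z [z' [h [[e De <-] [_ [e' De' <-] <-] h01]]]].
  by rewrite rC; simpc => -[-> ->]; exists e, e'.
move=> [e [e' [De De' y01 xE]]].
exists e%:C, (r%:R * e'%:C + (0 +i* 1)), y; split=> //; first by exists e.
  by exists e'%:C => //; exists e'.
by rewrite rC; simpc; rewrite xE.
Qed.

(** Truncation after [m] digits costs each endpoint series at most [(q ^+ m)^-1], and the weights
    [1 - y] and [y * r] add up to at most the width [q]. *)
Lemma segment_union_cover2 m :
  plane_of (segment_union (@setE R r) (@setE' R r)) `<=` cover2 r m.
Proof.
move=> [x y] /segment_unionE[e [e' [[a ae] [b be'] y01 xE]]].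
split=> //=; exists (fun j => (a (m - j)%N, b (m - j)%N)).
pose z j : I := (a j, b j).
rewrite dsum_slice (dsum_rev fst z) (dsum_rev snd z) -/(psum _ _).
have /andP[e0 e1] := psum_lim m ae; have /andP[e'0 e'1] := psum_lim m be'.
rewrite [fst \o z](_ : _ = a)// [snd \o z](_ : _ = b)//.
move: y01 => /andP[y0 y1].
have qm := qn_gt0 m.
have mono t u v : 0 <= t -> u <= v -> q ^+ m * (t * u) <= q ^+ m * (t * v).
  by move=> t0 uv; rewrite ler_pM2l// ler_wpM2l.
have := mono (1 - y) _ _ _ e0; have := mono (1 - y) _ _ _ e1.
have yr : 0 <= y * r%:R by rewrite mulr_ge0.
have := mono (y * r%:R) _ _ yr e'0; have := mono (y * r%:R) _ _ yr e'1.
rewrite subr_ge0 => h1 h2 /(_ y1) h3 /(_ y1) h4.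
have qq : q ^+ m * (q ^+ m)^-1 = 1 by rewrite divff// lt0r_neq0.
have rq : r%:R <= q.
  by rewrite ler_nat card_prod card_ord leq_pmulr// ltnW.
have r1 : 1 <= r%:R :> R by rewrite ler1n ltnW.
have yrq : (1 - y) + y * r%:R <= q by nra.
rewrite xE; apply/andP; split; first lra.
apply: (@le_trans _ _ (q ^+ m * ((1 - y) * psum a m + y * r%:R * psum b m) +
    ((1 - y) + y * r%:R) * (q ^+ m * (q ^+ m)^-1))); first by lra.
rewrite qq; lra.
Qed.

End digit_series.

(** * Directions *)

Section directions.
Context (R : realType) (r : nat).
Hypothesis r2 : (2 <= r)%N.

Local Notation I := ('I_r * 'I_r)%type.
Local Notation q := (#|{: I}|%:R : R).

(** The integer part of [q * v] is split in base [r] into two digits. The condition on [v] stands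
    inside the existential so that choice yields a total function. *)
Lemma digit_step (v : R) : exists t : I * R, 0 <= v < 1 ->
  0 <= t.2 < 1 /\ q * v = r%:R * snd_dig R t.1 + fst_dig R t.1 + t.2.
Proof.
have [v01|nv] := pselect (0 <= v < 1); last first.
  by exists ((Ordinal (ltnW r2), Ordinal (ltnW r2)), 0).
have /andP[v0 v1] := v01.
have q0 : 0 < q by rewrite ltr0n (leq_trans _ (card_digit_pairs_ge4 r2)).
have qv0 : 0 <= q * v by rewrite mulr_ge0// ltW.
pose k := Num.truncn (q * v).
have /andP[k0 k1] : k%:R <= q * v < k.+1%:R by rewrite truncn_itv.
have kq : (k < r * r)%N.
  have : k%:R < q by rewrite (le_lt_trans k0)// gtr_pMr.
  by rewrite ltr_nat card_prod !card_ord.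
have r0 : (0 < r)%N by exact: ltnW.
have kd : (k %/ r < r)%N by rewrite ltn_divLR.
exists ((Ordinal (ltn_pmod k r0), Ordinal kd), q * v - k%:R) => _ /=.
rewrite subr_ge0 k0 ltrBlDl natr1 k1; split=> //.
by rewrite /snd_dig /fst_dig /= -natrM -natrD mulnC -divn_eq; ring.
Qed.

Lemma expansion_exists (v : R) : 0 <= v < 1 ->
  exists (a b : nat -> 'I_r), forall n,
    `|r%:R * psum R b n + psum R a n - v| <= (q ^+ n)^-1.
Proof.
move=> v01; have [F FP] := choice digit_step.
(* The remainders of the expansion; the error after [n] digits is [V n / q ^+ n]. *)
pose V n := iter n (fun v => (F v).2) v.
have V01 n : 0 <= V n < 1.
  by elim: n => //= n IH; have [] := FP _ IH.
(* The predecessor appears because [psum] numbers digits from 1, whereas the remainders start at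
   [V 0]. *)
exists (fun j => (F (V j.-1)).1.1), (fun j => (F (V j.-1)).1.2) => n.
have qn m : 0 < q ^+ m.
  by rewrite exprn_gt0// ltr0n (leq_trans _ (card_digit_pairs_ge4 r2)).
set b := psum _ _ n; set a := psum _ _ n.
have -> : r%:R * b + a - v = - (V n / q ^+ n).
  rewrite {}/a {}/b; elim: n => [|n IH].
    by rewrite !psum0 expr0 mulr0 addr0 divr1 sub0r.
  have [_ VE] := FP _ (V01 n).
  rewrite !psumS.
  set b := psum _ _ n in IH *; set a := psum _ _ n in IH *.
  set y : R := (nat_of_ord (F (V n)).1.2)%:R; set x : R := (nat_of_ord (F (V n)).1.1)%:R.
  have VS : V n.+1 = q * V n - (r%:R * y + x) by rewrite VE addrC addKr.
  rewrite -[LHS]/(r%:R * (b + y / q ^+ n.+1) + (a + x / q ^+ n.+1) - v).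
  have -> : r%:R * (b + y / q ^+ n.+1) + (a + x / q ^+ n.+1) - v =
      (r%:R * b + a - v) + (r%:R * y + x) / q ^+ n.+1 by ring.
  rewrite IH VS exprS; field; rewrite !lt0r_neq0//.
  by have := qn 1%N; rewrite expr1.
have /andP[V0 V1] := V01 n.
rewrite normrN normrM normfV (ger0_norm V0) (gtr0_norm (qn n)).
by rewrite -[leRHS]mul1r ler_pM2r ?invr_gt0// ltW.
Qed.

(** Complementing digits reflects E: if all digits of [c] are [r - 1], then [c - A] is in E whenever
    [A] is. This turns the sums [r * e' + A], which represent every [v], into differences. *)
Lemma digit_set_differences : exists c : R, forall v, 0 <= v < 1 ->
  exists e e', [/\ @digit_set R r e, @digit_set R r e' & r%:R * e' - e = v - c].
Proof.
pose top : 'I_r := rev_ord (Ordinal (ltnW r2)).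
pose c := limn (psum R (fun=> top)).
have cc : psum R (fun=> top) @ \oo --> c by exact: is_cvg_psum.
exists c => v v01; have [a [b ab]] := expansion_exists v01.
have ca : psum R a @ \oo --> limn (psum R a) by exact: is_cvg_psum.
have cb : psum R b @ \oo --> limn (psum R b) by exact: is_cvg_psum.
set A := limn (psum R a) in ca; set e' := limn (psum R b) in cb.
exists (c - A), e'; split.
- exists (fun j => rev_ord (a j)).
  have -> : (fun n => \sum_(1 <= j < n.+1) (rev_ord (a j))%:R * (r%:R : R) ^- (2 * j)) =
     (fun n => psum R (fun=> top) n - psum R a n).
    apply/funext => n; rewrite /psum -sumrB; apply: eq_bigr => j _.
    rewrite -mulrBl; congr (_ * _).
    by rewrite /= -natrB; [congr (_%:R); rewrite subn1; have := ltn_ord (a j); lia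
                          |have := ltn_ord (a j); lia].
  exact: cvgB.
- by exists b.
suff : r%:R * e' + A = v by lra.
have cv : r%:R * psum R b n + psum R a n - v @[n --> \oo] --> r%:R * e' + A - v.
  by apply: cvgB; [apply: cvgD => //; apply: cvgM => //; exact: cvg_cst|exact: cvg_cst].
have q0 : (fun n => (q ^+ n)^-1) @ \oo --> (0 : R).
  have -> : (fun n => (q ^+ n)^-1) = geometric 1 q^-1.
    by apply/funext => n; rewrite /geometric/= mul1r exprVn.
  apply: cvg_geometric; rewrite normfV ger0_norm// invf_lt1 ?ltr1n.
    by rewrite (leq_trans _ (card_digit_pairs_ge4 r2)).
  by rewrite ltr0n (leq_trans _ (card_digit_pairs_ge4 r2)).
apply/eqP; rewrite -subr_eq0; apply/eqP.
apply: (cvg_unique (@Rhausdorff R) cv).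
apply: norm_cvg0; apply: (@squeeze_cvgr _ _ _ _ (cst 0) (fun n => (q ^+ n)^-1)) => //.
- by apply: nearW => n; rewrite /= normr_ge0 ab.
- exact: cvg_cst.
Qed.

Lemma segment_union_directions : exists U : set (R * R),
  [/\ open U, U `&` @unit_circle R !=set0 & forall u, (U `&` @unit_circle R) u ->
    contains_segment (plane_of (segment_union (@setE R r) (@setE' R r))) u].
Proof.
have [c cP] := digit_set_differences.
have copen (f : R * R -> R) : continuous f -> open [set u | 0 < f u].
  move=> cf; apply: (@open_comp _ _ f [set x | 0 < x]); first by move=> x _; exact: cf.
  exact: open_gt.
have c1 : continuous (fun u : R * R => u.1) by move=> u; exact: cvg_fst.
have c2 : continuous (fun u : R * R => u.2) by move=> u; exact: cvg_snd.
(* For [u.2 > 0] the other two conditions say that [u.1 / u.2 + c] lies strictly between 0 and 1. *)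
exists ([set u | 0 < u.2] `&`
  ([set u | 0 < u.1 + c * u.2] `&` [set u | 0 < (1 - c) * u.2 - u.1])).
split.
- apply: openI; [exact: copen|apply: openI; apply: copen => u].
    by apply: cvgD; [exact: c1|apply: cvgM; [exact: cvg_cst|exact: c2]].
  by apply: cvgB; [apply: cvgM; [exact: cvg_cst|exact: c2]|exact: c1].
(* The slope [w] puts [w + c] at the midpoint 1/2, and [N] normalizes the vector. *)
- pose w := 2^-1 - c; pose N := Num.sqrt (1 + w ^+ 2).
  have w0 : 0 < 1 + w ^+ 2 by rewrite ltr_pwDl// sqr_ge0.
  have N0 : 0 < N by rewrite sqrtr_gt0.
  exists (w / N, N^-1); split=> /=.
    rewrite invr_gt0; split=> //; split.
      by rewrite -mulrDl divr_gt0// /w subrK.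
    by rewrite -mulrBl divr_gt0// /w; lra.
  rewrite /unit_circle /= exprMn -{2}[N^-1]mul1r exprMn expr1n -mulrDl.
  by rewrite exprVn sqr_sqrtr ?ltW// addrC divff// lt0r_neq0.
- move=> u [[/= u2 [ul ur]] _].
  have v01 : 0 <= u.1 / u.2 + c < 1.
    rewrite -ltrBrDr ltr_pdivrMr// -[c in leRHS](mulfK (lt0r_neq0 u2)) -mulrDl.
    by rewrite divr_ge0 ?ltW//= -subr_gt0.
  have [e [e' [De De' ee]]] := cP _ v01.
  (* The segment starts at [e] on the real axis, and the length [u.2^-1] takes it exactly to height
     1. *)
  exists (e, 0), u.2^-1; split; first by rewrite invr_gt0.
  move=> t /andP[t0 t1] /=; rewrite add0r; apply/segment_unionE.
  exists e, e'; split=> //.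
    by rewrite mulr_ge0 ?(ltW u2)//= -ler_pdivlMr// div1r.
  have -> : (1 - t * u.2) * e + t * u.2 * (r%:R * e') =
            e + t * u.2 * (r%:R * e' - e) by ring.
  by rewrite ee addrK; field; rewrite lt0r_neq0.
Qed.

End directions.

Theorem mainTheorem3 (R : realType) (r : nat) (hr : prime r) :
  besicovitch_wide (plane_of (segment_union (@setE R r) (@setE' R r))).
Proof.
have r2 : (2 <= r)%N := prime_gt1 hr.
split; last exact: segment_union_directions.
exists (\bigcap_m @cover2 R r m); split.
- by apply: bigcapT_measurable => m; exact: measurable_cover2.
- exact: cover2_null.
- by move=> p Bp m _; exact: segment_union_cover2.
Qed.
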